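(* There exist connected graphs $G, G_1, G_2$ and regular covering maps $G\to G_1$ and $G\to G_2$ such that $G_1$ and $G_2$ are finite, but there does not exist a covering $G\to\hat{G}$ of any finite graph $\hat{G}$ such that $\hat{G}$ covers both $G_1$ and $G_2$. (Here arbitrary coverings $G\to\hat G$, $\hat G\to G_1$, $\hat G\to G_2$ are excluded, not only those whose compositions are the given coverings $G\to G_i$.)
   Context: Graphs are 1-dimensional cell complexes (loops and multiple edges are allowed), metrized so that each edge has length $1$. A graph is finite if it has finitely many vertices and edges. Morphisms of graphs map vertices to vertices and restrict to local isometries on edges; in particular, covering maps between graphs are morphisms of this kind. ''$A$ covers $B$'' means that there exists a covering map $A\to B$. A covering is regular if its group of deck transformations acts transitively on each fibre. *)

(* Defs.v *)
From mathcomp Require Import all_boot.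
From mathcomp Require Import boolp classical_sets functions cardinality.
From Stdlib Require Relation_Operators.

Set Implicit Arguments.
Unset Strict Implicit.
Unset Printing Implicit Defensive.

Local Open Scope classical_set_scope.

(* A 1-dimensional cell complex, loops and multiple edges allowed, possibly
   infinite, is given by its vertices and its oriented edges (darts).  An edge
   of the complex is a pair {d, inv d}; [inv_neq] says that an edge differs
   from itself with the opposite orientation, also when it is a loop. *)
Record graph := Graph {
  vertex : Type;
  dart : Type;
  src : dart -> vertex;
  inv : dart -> dart;
  invK : forall d, inv (inv d) = d;
  inv_neq : forall d, inv d <> d }.

Definition tgt (G : graph) (d : dart G) : vertex G := src (inv d).

(* A loop contributes two darts to the star of its vertex, so stars
   describe small neighbourhoods of vertices in the cell complex. *)
Definition star (G : graph) (v : vertex G) : set (dart G) :=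
  [set d | src d = v].

Definition finite_graph (G : graph) : Prop :=
  finite_set [set: vertex G] /\ finite_set [set: dart G].

Definition adjacent (G : graph) (u v : vertex G) : Prop :=
  exists d : dart G, src d = u /\ tgt d = v.

Definition connected_graph (G : graph) : Prop :=
  inhabited (vertex G) /\
  forall u v : vertex G,
    Relation_Operators.clos_refl_trans (vertex G) (@adjacent G) u v.

(* A cellular map that is a local isometry on every edge carries each unit
   edge isometrically onto a unit edge, hence acts on darts; conversely its
   action on vertices and darts determines it. *)
Record morphism (G H : graph) := Morphism {
  mvertex : vertex G -> vertex H;
  mdart : dart G -> dart H;
  msrc : forall d, src (mdart d) = mvertex (src d);
  minv : forall d, mdart (inv d) = inv (mdart d) }.

(* Covering maps are surjective; being a local homeomorphism at a vertex means
   being bijective from its star to the star of its image. *)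
Definition covering (G H : graph) (p : morphism G H) : Prop :=
  (forall w : vertex H, exists v : vertex G, mvertex p v = w) /\
  (forall v : vertex G, set_bij (star v) (star (mvertex p v)) (mdart p)).

Definition covers (G H : graph) : Prop := exists p : morphism G H, covering p.

Definition automorphism (G : graph) (a : morphism G G) : Prop :=
  bijective (mvertex a) /\ bijective (mdart a).

Definition deck_transformation (G H : graph) (p : morphism G H)
    (a : morphism G G) : Prop :=
  [/\ automorphism a,
      forall v, mvertex p (mvertex a v) = mvertex p v
    & forall d, mdart p (mdart a d) = mdart p d].

(* The second clause treats the fibres over interior points of edges: the
   points over a given interior point of an edge, oriented as a dart e, are in
   bijection with the darts over e. *)
Definition regular_covering (G H : graph) (p : morphism G H) : Prop :=
  [/\ covering p,
      forall u v : vertex G, mvertex p u = mvertex p v ->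
        exists a, deck_transformation p a /\ mvertex a u = v
    & forall d e : dart G, mdart p d = mdart p e ->
        exists a, deck_transformation p a /\ mdart a d = e].

(* Main.v *)
(* Let x, y be transpositions generating S3, acting on three arms, let t be the
   shift of the lamplighter group L = S3 wr Z, and let x, y also denote the
   elements of L acting at the lamp at 0.  Take a hub with a loop t and three
   arms; an arm is an inner vertex, joined to the hub, followed by an outer
   vertex.  In G1 every inner vertex carries a loop x and every outer vertex a
   loop y; in G2 these edges lead instead to the neighbours x i and y i of the
   arm i.  Lifting t, x, y to L gives a voltage graph over G2, which becomes a
   voltage graph over G1 when the arms are relabelled at each element of L by
   the state of its current lamp.  This is G.

   The degrees 5, 4, 3 of hub, inner and outer vertices make all coverings
   respect the kinds of vertices.  If G covers a finite graph N, some k > 0 is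
   such that all hubs g and g t^k have the same image in N.  Therefore one may
   press x at 0 and y at k alternately, switching between g and g t^k without
   moving in N.  As x and t^k y t^-k commute in L, the path in N of the commutator
   of x and y ends at an arm of the hub at which it began.  Seen in G1 it ends
   at the same arm, but seen in G2 it ends at another one, since yxyx is a
   3-cycle. *)
From HB Require Import structures.
From mathcomp Require Import all_boot.
From mathcomp Require Import fingroup perm ssralg ssrint zify.
From mathcomp Require Import boolp classical_sets functions cardinality.
From Stdlib Require Import Relation_Operators.
Require Import Defs.

Set Implicit Arguments.
Unset Strict Implicit.
Unset Printing Implicit Defensive.

Import GRing.Theory.

Local Open Scope classical_set_scope.
Local Open Scope card_scope.

(** * Graphs, coverings and isomorphisms *)

(** The dart [(e, false)] runs from [head e] to [tail e], in spite of the names; [(e, true)] runs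
    back. *)
Definition edge_graph (V E : Type) (head tail : E -> V) : graph.
Proof.
refine (@Graph V (E * bool) (fun d => if d.2 then tail d.1 else head d.1)
  (fun d => (d.1, ~~ d.2)) _ _).
- by move=> [e o] /=; rewrite negbK.
- by move=> [e []].
Defined.

Definition compm (G H K : graph) (p : morphism G H) (q : morphism H K) :
  morphism G K.
Proof.
refine (@Morphism G K (mvertex q \o mvertex p) (mdart q \o mdart p) _ _).
- by move=> d /=; rewrite !msrc.
- by move=> d /=; rewrite !minv.
Defined.

Lemma morphism_tgt (G H : graph) (p : morphism G H) (d : dart G) :
  tgt (mdart p d) = mvertex p (tgt d).
Proof. by rewrite /tgt -minv msrc. Qed.

Lemma adjacent_sym (G : graph) (u v : vertex G) : adjacent u v -> adjacent v u.
Proof. by move=> [d [<- <-]]; exists (inv d); rewrite /tgt invK. Qed.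

Lemma morphism_adjacent (G H : graph) (p : morphism G H) (u v : vertex G) :
  adjacent u v -> adjacent (mvertex p u) (mvertex p v).
Proof. by move=> [d [<- <-]]; exists (mdart p d); rewrite msrc morphism_tgt. Qed.

Lemma connected_from (G : graph) (v0 : vertex G) :
  (forall v, clos_refl_trans _ (@adjacent G) v0 v) -> connected_graph G.
Proof.
move=> conn; split; first exact: inhabits v0.
have sym u v : clos_refl_trans _ (@adjacent G) u v ->
    clos_refl_trans _ (@adjacent G) v u.
  elim=> [x y /adjacent_sym|x|x y z _ yx _ zy]; first exact: rt_step.
    exact: rt_refl.
  exact: rt_trans zy yx.
by move=> u v; apply: rt_trans (conn v); apply: sym.
Qed.

Lemma connected_image (G H : graph) (p : morphism G H) :
  (forall w, exists v, mvertex p v = w) -> connected_graph G ->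
  connected_graph H.
Proof.
move=> psurj [[v0] conn]; apply: (@connected_from _ (mvertex p v0)) => w.
have [v <-] := psurj w.
elim: (conn v0 v) => [x y /(morphism_adjacent p)|x|x y z _ xy _ yz].
- exact: rt_step.
- exact: rt_refl.
- exact: rt_trans xy yz.
Qed.

Lemma covering_comp (G H K : graph) (p : morphism G H) (q : morphism H K) :
  covering p -> covering q -> covering (compm p q).
Proof.
move=> [psurj pbij] [qsurj qbij]; split=> [w|v].
  have [u <-] := qsurj w; have [v <-] := psurj u; by exists v.
have [pfun pinj ponto] := pbij v; have [qfun qinj qonto] := qbij (mvertex p v).
split=> [d /pfun/qfun//|d d' vd vd' /= eq_d|d /qonto[d1 /ponto[d2 vd2 <-] <-]].
- apply: pinj => //; apply: qinj => //.
    by rewrite inE; apply: pfun; rewrite -inE.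
  by rewrite inE; apply: pfun; rewrite -inE.
- by exists d2.
Qed.

Definition isomorphism (G H : graph) (p : morphism G H) : Prop :=
  bijective (mvertex p) /\ bijective (mdart p).

Lemma isomorphism_inverse (G H : graph) (p : morphism G H) :
  isomorphism p -> exists q : morphism H G,
    [/\ cancel (mvertex p) (mvertex q), cancel (mvertex q) (mvertex p),
        cancel (mdart p) (mdart q) & cancel (mdart q) (mdart p)].
Proof.
move=> [[qv pvK qvK] [qd pdK qdK]].
have qsrc d : src (qd d) = qv (src d).
  by rewrite -{2}(qdK d) msrc pvK.
have qinv d : qd (inv d) = inv (qd d).
  by rewrite -{1}(qdK d) -minv pdK.
by exists (Morphism qsrc qinv).
Qed.

Lemma isomorphism_covering (G H : graph) (p : morphism G H) :
  isomorphism p -> covering p.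
Proof.
move=> /isomorphism_inverse[q [pvK qvK pdK qdK]].
split=> [w|v]; first by exists (mvertex q w).
split=> [d <-|d d' _ _ /(can_inj pdK)//|d vd].
  exact: msrc.
by exists (mdart q d); rewrite ?qdK //= /star /= msrc vd pvK.
Qed.

(** Conjugating by [p] turns deck transformations of [q] into deck transformations of the
    composite. *)
Lemma regular_comp_isomorphism (G H K : graph) (p : morphism G H)
    (q : morphism H K) :
  isomorphism p -> regular_covering q -> regular_covering (compm p q).
Proof.
move=> piso [qcov qvert qdart].
have [r [pvK rvK pdK rdK]] := isomorphism_inverse piso.
have conj a : deck_transformation q a ->
    deck_transformation (compm p q) (compm p (compm a r)).
  move=> [[abijv abijd] av ad]; split=> [|v|d] /=.
  - have [pbijv pbijd] := piso.
    have rbijv : bijective (mvertex r) by exists (mvertex p).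
    have rbijd : bijective (mdart r) by exists (mdart p).
    by split; [exact: bij_comp (bij_comp rbijv abijv) pbijv |
               exact: bij_comp (bij_comp rbijd abijd) pbijd].
  - by rewrite rvK av.
  - by rewrite rdK ad.
split; first exact: covering_comp (isomorphism_covering piso) qcov.
- move=> u v /qvert[a [adeck eq_a]]; exists (compm p (compm a r)).
  by split; [exact: conj | rewrite /= eq_a pvK].
- move=> d e /qdart[a [adeck eq_a]]; exists (compm p (compm a r)).
  by split; [exact: conj | rewrite /= eq_a pdK].
Qed.

(** * The lamplighter group S3 wr Z *)

Definition arm := option bool.

Definition swapx : {perm arm} := tperm None (Some true).
Definition swapy : {perm arm} := tperm (Some true) (Some false).

Lemma swapxK : involutive swapx.
Proof. exact: tpermK. Qed.

Lemma swapyK : involutive swapy.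
Proof. exact: tpermK. Qed.

Variant letter := Fwd | Bwd | PressX | PressY.

Definition letter_inv (l : letter) : letter :=
  match l with Fwd => Bwd | Bwd => Fwd | _ => l end.

Definition letter_act (l : letter) (p : int * arm) : int * arm :=
  match l with
  | Fwd => ((p.1 + 1)%R, p.2)
  | Bwd => ((p.1 - 1)%R, p.2)
  | PressX => (p.1, if p.1 == 0%R then swapx p.2 else p.2)
  | PressY => (p.1, if p.1 == 0%R then swapy p.2 else p.2)
  end.

Lemma letter_actK (l : letter) :
  cancel (letter_act l) (letter_act (letter_inv l)).
Proof.
move=> [n i]; case: l => /=; rewrite ?addrK ?subrK //.
- by case: (n == 0%R); rewrite ?swapxK.
- by case: (n == 0%R); rewrite ?swapyK.
Qed.

Definition word_act (w : seq letter) : int * arm -> int * arm :=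
  foldr (fun l f => letter_act l \o f) id w.

Definition word_inv (w : seq letter) : seq letter := rev (map letter_inv w).

Lemma word_act_cat (u w : seq letter) :
  word_act (u ++ w) = word_act u \o word_act w.
Proof. by elim: u => //= l u ->. Qed.

Lemma word_actK (w : seq letter) : cancel (word_act w) (word_act (word_inv w)).
Proof.
elim: w => //= l w IHw p.
rewrite /word_inv /= rev_cons -cats1 word_act_cat /= letter_actK.
exact: IHw.
Qed.

Lemma word_invK : involutive word_inv.
Proof.
move=> w; rewrite /word_inv map_rev revK -map_comp.
by elim: w => //= l w ->; case: l.
Qed.

(** S3 wr Z acts faithfully on positions and arms, so its elements are taken to be maps. The word is
    only asserted to exist, which makes equality that of maps. *)
Definition lamplighter :=
  {g : int * arm -> int * arm | exists w, g = word_act w}.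

Lemma lamplighter_inj (g h : lamplighter) : sval g =1 sval h -> g = h.
Proof.
by move: g h => [g gP] [h hP] /= /funext gh; apply: eq_exist.
Qed.

Definition lone : lamplighter := exist _ id (ex_intro _ [::] erefl).

Definition lmul (g h : lamplighter) : lamplighter.
Proof.
exists (sval g \o sval h).
have [[u ->] [w ->]] := (svalP g, svalP h); exists (u ++ w).
by rewrite word_act_cat.
Defined.

Definition lword (w : seq letter) : lamplighter :=
  exist _ (word_act w) (ex_intro _ w erefl).

Definition rword (g : lamplighter) (w : seq letter) : lamplighter :=
  lmul g (lword w).

Lemma lmulA (g h k : lamplighter) : lmul g (lmul h k) = lmul (lmul g h) k.
Proof. exact: lamplighter_inj. Qed.

Lemma rword_cat (g : lamplighter) (u w : seq letter) :
  rword (rword g u) w = rword g (u ++ w).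
Proof. by apply: lamplighter_inj => p /=; rewrite word_act_cat. Qed.

Lemma rword_id (g : lamplighter) (w : seq letter) :
  word_act w =1 id -> rword g w = g.
Proof. by move=> w1; apply: lamplighter_inj => p /=; rewrite w1. Qed.

Lemma rwordK (w : seq letter) : cancel (rword^~ w) (rword^~ (word_inv w)).
Proof.
move=> g; rewrite rword_cat rword_id // => p.
by rewrite -{1}[w]word_invK word_act_cat /= word_actK.
Qed.

Lemma rwordVK (w : seq letter) : cancel (rword^~ (word_inv w)) (rword^~ w).
Proof. by move=> g; rewrite -{2}[w]word_invK rwordK. Qed.

Lemma lamplighter_transitive (g g' : lamplighter) :
  exists h h', [/\ lmul h g = g', cancel (lmul h) (lmul h')
                 & cancel (lmul h') (lmul h)].
Proof.
have inverse (k : lamplighter) :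
    exists k', lmul k k' = lone /\ lmul k' k = lone.
  have [w kE] := svalP k; exists (lword (word_inv w)).
  split; apply: lamplighter_inj => p /=; rewrite kE ?word_actK //.
  by rewrite -{1}[w]word_invK word_actK.
have [gi [ggi gig]] := inverse g.
have [g'i [g'gi gig']] := inverse g'.
have lone_mul k : lmul lone k = k by exact: lamplighter_inj.
have mul_lone k : lmul k lone = k by exact: lamplighter_inj.
exists (lmul g' gi), (lmul g g'i); split=> [|k|k].
- by rewrite -lmulA gig mul_lone.
- by rewrite !lmulA -(lmulA g) gig' mul_lone ggi lone_mul.
- by rewrite !lmulA -(lmulA g') gig mul_lone g'gi lone_mul.
Qed.

(** Words carry whole fibres to fibres; this makes the arm part of the action injective on each
    fibre, as [lamp] needs. *)
Lemma word_act_fst (w : seq letter) (n : int) (i j : arm) :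
  (word_act w (n, i)).1 = (word_act w (n, j)).1.
Proof. by elim: w => //= l w IHw; case: l => /=; rewrite IHw. Qed.

(* [lamp g] is how [g] permutes the arms on its way from the fibre of 0 to the
   fibre it sends it to; [insubd] is harmless by [lampE]. *)
Definition lamp (g : lamplighter) : {perm arm} :=
  insubd (1%g : {perm arm}) [ffun i : arm => (sval g (0%R, i)).2].

Lemma lampE (g : lamplighter) (i : arm) : lamp g i = (sval g (0%R, i)).2.
Proof.
rewrite -pvalE insubdK ?ffunE //.
apply/injectiveP => j k; rewrite !ffunE.
have [w ->] := svalP g => eq2.
have eq1 := word_act_fst w 0%R j k.
have: word_act w (0%R, j) = word_act w (0%R, k).
  by move: eq1 eq2; case: word_act => a b; case: word_act => c d /= -> ->.
by move/(can_inj (word_actK w)) => -[].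
Qed.

(** The letter multiplies on the right, hence acts before [g], where it undoes [swapx]. So an x-edge
    that permutes arms becomes a loop after relabelling. *)
Lemma lamp_pressx (g : lamplighter) (i : arm) :
  lamp (rword g [:: PressX]) (swapx i) = lamp g i.
Proof. by rewrite !lampE /= swapxK. Qed.

Lemma lamp_pressy (g : lamplighter) (i : arm) :
  lamp (rword g [:: PressY]) (swapy i) = lamp g i.
Proof. by rewrite !lampE /= swapyK. Qed.

Lemma word_act_fwd (k : nat) (n : int) (i : arm) :
  word_act (nseq k Fwd) (n, i) = ((n + k%:Z)%R, i).
Proof.
elim: k => [|k IHk] /=; first by rewrite addr0.
by rewrite IHk /= -addrA -addn1 PoszD.
Qed.

Lemma word_act_bwd (k : nat) (n : int) (i : arm) :
  word_act (nseq k Bwd) (n, i) = ((n - k%:Z)%R, i).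
Proof.
elim: k => [|k IHk] /=; first by rewrite subr0.
by rewrite IHk /= -addrA -opprD -addn1 PoszD.
Qed.

(* The lamps at 0 and at [k] are pressed twice each, in alternation. *)
Lemma tour_closed (g : lamplighter) (k : nat) : 0 < k ->
  let u := PressX :: nseq k Fwd ++ PressY :: nseq k Bwd in
  rword (rword g u) u = g.
Proof.
move=> k_gt0 u; rewrite rword_cat rword_id // => -[n i].
have uE m j : word_act u (m, j) =
    (m, if m == 0%R then swapx j else if m == Posz k then swapy j else j).
  rewrite /u /= word_act_cat /= word_act_bwd /= word_act_fwd /= subrK.
  rewrite subr_eq0; case: eqVneq => [->|//].
  by case: eqVneq => // ke; move: k_gt0; rewrite -ltz_nat -ke.
rewrite word_act_cat /comp !uE.
by case: (n == 0%R); case: (n == Posz k); rewrite ?swapxK ?swapyK.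
Qed.

(** * Voltage graphs and their regular projections *)

(** Edges multiply by their voltage on the right, which leaves left multiplication free to act by
    deck transformations. *)
Definition voltage_graph (V E : Type) (head tail : E -> V)
    (volt : E -> seq letter) : graph :=
  @edge_graph (lamplighter * V)%type (lamplighter * E)%type
    (fun e => (e.1, head e.2)) (fun e => (rword e.1 (volt e.2), tail e.2)).

Section Projection.
Context (V E : Type) (head tail : E -> V) (volt : E -> seq letter).

Definition projection :
  morphism (voltage_graph head tail volt) (edge_graph head tail).
Proof.
refine (@Morphism (voltage_graph head tail volt) (edge_graph head tail)
  snd (fun d => (d.1.2, d.2)) _ _).
- by move=> [[g e] []].
- by move=> [[g e] o].
Defined.

Definition translation (h : lamplighter) :
  morphism (voltage_graph head tail volt) (voltage_graph head tail volt).
Proof.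
refine (@Morphism (voltage_graph head tail volt)
  (voltage_graph head tail volt) (fun v => (lmul h v.1, v.2))
  (fun d => ((lmul h d.1.1, d.1.2), d.2)) _ _).
- by move=> [[g e] []] //=; rewrite /rword lmulA.
- by move=> [[g e] o].
Defined.

Lemma projection_covering : covering projection.
Proof.
split=> [v|[g v]]; first by exists (lone, v).
split.
- by move=> [[g' e] []] [_ <-].
- move=> [[g1 e1] o1] [[g2 e2] o2]; rewrite !inE => v1 v2 [ee oo].
  move: v1 v2; rewrite ee oo; case: o2 {oo} => -[+ _] [+ _] /= => e1g e2g.
    by rewrite (can_inj (rwordK _) (etrans e1g (esym e2g))).
  by rewrite e1g e2g.
- move=> [e []] /= ev.
    (* A reversed dart starts at the shifted sheet, so the lift from [g] belongs to the edge based
       at [g] times the inverse voltage. *)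
    exists ((rword g (word_inv (volt e)), e), true) => //.
    by rewrite /star /= rwordVK -ev.
  by exists ((g, e), false) => //; rewrite /star /= -ev.
Qed.

Lemma projection_regular : regular_covering projection.
Proof.
have deck (g g' : lamplighter) : exists h,
    deck_transformation projection (translation h) /\ lmul h g = g'.
  have [h [h' [hg hK h'K]]] := lamplighter_transitive g g'.
  exists h; split=> //; split=> //; split.
  - by exists (fun v => (lmul h' v.1, v.2)) => -[k v] /=; rewrite (hK, h'K).
  - by exists (fun d => ((lmul h' d.1.1, d.1.2), d.2)) => -[[k e] o] /=;
      rewrite (hK, h'K).
split; first exact: projection_covering.
- move=> [g v] [g' v'] /= <-; have [h [hdeck <-]] := deck g g'.
  by exists (translation h).
- move=> [[g e] o] [[g' e'] o'] [<- <-]; have [h [hdeck <-]] := deck g g'.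
  by exists (translation h).
Qed.

End Projection.

(** * The two finite graphs and their common cover *)

Inductive place := Hub | Inner of arm | Outer of arm.

Inductive edge := Track | Spoke of arm | Link of arm | Inring of arm
  | Outring of arm.

Definition place_code (v : place) : option (bool * arm) :=
  match v with
  | Hub => None | Inner i => Some (false, i) | Outer i => Some (true, i)
  end.

Definition place_decode (c : option (bool * arm)) : place :=
  match c with
  | None => Hub | Some (false, i) => Inner i | Some (true, i) => Outer i
  end.

Lemma place_codeK : cancel place_code place_decode.
Proof. by case. Qed.

HB.instance Definition _ := Finite.copy place (can_type place_codeK).

Definition edge_code (e : edge) : option (bool * bool * arm) :=
  match e with
  | Track => None
  | Spoke i => Some (false, false, i)
  | Link i => Some (false, true, i)
  | Inring i => Some (true, false, i)
  | Outring i => Some (true, true, i)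
  end.

Definition edge_decode (c : option (bool * bool * arm)) : edge :=
  match c with
  | None => Track
  | Some (false, false, i) => Spoke i
  | Some (false, true, i) => Link i
  | Some (true, false, i) => Inring i
  | Some (true, true, i) => Outring i
  end.

Lemma edge_codeK : cancel edge_code edge_decode.
Proof. by case. Qed.

HB.instance Definition _ := Finite.copy edge (can_type edge_codeK).

Definition head (e : edge) : place :=
  match e with
  | Track | Spoke _ => Hub
  | Link i | Inring i => Inner i
  | Outring i => Outer i
  end.

Definition act (b : bool) (s : {perm arm}) (i : arm) : arm :=
  if b then s i else i.

(** [false] gives the graph with loops, [true] the one whose rings permute the arms. There, two
    transposed arms are joined by two edges, so degrees agree with those of the loops. *)
Definition tail (b : bool) (e : edge) : place :=
  match e with
  | Track => Hub
  | Spoke i => Inner i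
  | Link i => Outer i
  | Inring i => Inner (act b swapx i)
  | Outring i => Outer (act b swapy i)
  end.

Definition volt (e : edge) : seq letter :=
  match e with
  | Track => [:: Fwd] | Inring _ => [:: PressX] | Outring _ => [:: PressY]
  | _ => [::]
  end.

Definition quot (b : bool) : graph := edge_graph head (tail b).

Definition cover (b : bool) : graph := voltage_graph head (tail b) volt.

Definition place_map (s : {perm arm}) (v : place) : place :=
  match v with Hub => Hub | Inner i => Inner (s i) | Outer i => Outer (s i) end.

Definition edge_map (s : {perm arm}) (e : edge) : edge :=
  match e with
  | Track => Track
  | Spoke i => Spoke (s i)
  | Link i => Link (s i)
  | Inring i => Inring (s i)
  | Outring i => Outring (s i)
  end.

Lemma place_mapK (s : {perm arm}) :
  cancel (place_map s) (place_map s^-1%g) /\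
  cancel (place_map s^-1%g) (place_map s).
Proof. by split; case=> //= i; rewrite ?permK ?permKV. Qed.

Lemma edge_mapK (s : {perm arm}) :
  cancel (edge_map s) (edge_map s^-1%g) /\
  cancel (edge_map s^-1%g) (edge_map s).
Proof. by split; case=> //= i; rewrite ?permK ?permKV. Qed.

Lemma rword_nil (g : lamplighter) : rword g [::] = g.
Proof. exact: rword_id. Qed.

(* Relabelling the arms at [g] by [lamp g] turns the action of S3 on the arms
   into the trivial one. *)
Definition untwist : morphism (cover true) (cover false).
Proof.
refine (@Morphism (cover true) (cover false)
  (fun v => (v.1, place_map (lamp v.1) v.2))
  (fun d => ((d.1.1, edge_map (lamp d.1.1) d.1.2), d.2)) _ _).
- move=> [[g e] []]; last by case: e.
  by case: e => [|i|i|i|i] //=;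
    rewrite /act ?rword_nil ?lamp_pressx ?lamp_pressy.
- by move=> [[g e] o].
Defined.

Lemma untwist_isomorphism : isomorphism untwist.
Proof.
split.
- exists (fun v : lamplighter * place => (v.1, place_map (lamp v.1)^-1%g v.2));
    by move=> [g v] /=; have [sK s'K] := place_mapK (lamp g); rewrite (sK, s'K).
- exists (fun d : lamplighter * edge * bool =>
    ((d.1.1, edge_map (lamp d.1.1)^-1%g d.1.2), d.2));
  by move=> [[g e] o] /=; have [sK s'K] := edge_mapK (lamp g); rewrite (sK, s'K).
Qed.

Lemma finite_quot (b : bool) : finite_graph (quot b).
Proof. by split; exact: finite_finset. Qed.

Lemma connected_cover : connected_graph (cover true).
Proof.
pose conn := clos_refl_trans _ (@adjacent (cover true)).
have edge_conn (g : lamplighter) (e : edge) :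
    conn (g, head e) (rword g (volt e), tail true e) /\
    conn (rword g (volt e), tail true e) (g, head e).
  split; apply: rt_step; last apply: adjacent_sym;
    by exists ((g, e), false).
have inner g i : conn (g, Hub) (g, Inner i) /\ conn (g, Inner i) (g, Hub).
  by have := edge_conn g (Spoke i); rewrite /= rword_nil.
have outer g i : conn (g, Hub) (g, Outer i) /\ conn (g, Outer i) (g, Hub).
  have [hi ih] := inner g i.
  have := edge_conn g (Link i); rewrite /= rword_nil => -[io oi].
  by split; [exact: rt_trans hi io | exact: rt_trans oi ih].
(* [Fwd] and [Bwd] follow the track. The other letters are detours: out along an arm, through its
   ring edge, and back along the arm reached. *)
have letter_conn g l : conn (g, Hub) (rword g [:: l], Hub).
  case: l.
  - exact: (edge_conn g Track).1.
  - have := (edge_conn (rword g [:: Bwd]) Track).2.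
    by rewrite [rword _ _](rwordVK [:: Fwd]).
  - apply: rt_trans (inner g None).1 _.
    apply: rt_trans (edge_conn g (Inring None)).1 _.
    exact: (inner _ _).2.
  - apply: rt_trans (outer g None).1 _.
    apply: rt_trans (edge_conn g (Outring None)).1 _.
    exact: (outer _ _).2.
have word_conn w g : conn (g, Hub) (rword g w, Hub).
  elim: w g => [|l w IHw] g; first by rewrite rword_nil; apply: rt_refl.
  by apply: rt_trans (letter_conn g l) _; have := IHw (rword g [:: l]);
    rewrite rword_cat.
apply: (@connected_from (cover true) (lone, Hub)) => -[g v].
have hub_conn : conn (lone, Hub) (g, Hub).
  have [w gE] := svalP g; have -> : g = rword lone w.
    by apply: lamplighter_inj => p /=; rewrite gE.
  exact: word_conn.
case: v => [//|i|i].
- exact: rt_trans hub_conn (inner g i).1.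
- exact: rt_trans hub_conn (outer g i).1.
Qed.

(** * Uniform periods in finite sets *)

(** With [N] the cardinality of [T], the [N + 1] terms up to index [N] collide; the bound is the
    same for all sequences. *)
Lemma finite_pigeonhole (T : Type) : finite_set [set: T] ->
  exists N, forall a : nat -> T, exists i j, [/\ i < j, j <= N & a i = a j].
Proof.
move=> [N TN]; exists N => a; apply: contrapT => no_coll.
have inja : {in `I_N.+1 &, injective a}.
  move=> i j; rewrite !inE /= !ltnS => iN jN aij.
  by case: (ltngtP i j) => // ij; case: no_coll; [exists i, j | exists j, i].
have := card_leT (a @` `I_N.+1).
by rewrite (card_le_eql (inj_card_eq inja)) (card_le_eqr TN) card_le_II ltnn.
Qed.

(* [N`!] is a multiple of every period at most [N]. *)
Lemma finite_period (T : Type) : finite_set [set: T] ->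
  exists N k, 0 < k /\ forall a : nat -> T,
    (forall i j, a i = a j -> a i.+1 = a j.+1) -> a N = a (N + k).
Proof.
move=> /finite_pigeonhole[N coll]; exists N, N`!.
split=> [|a step]; first exact: fact_gt0.
have [i [j [ij jN aij]]] := coll a.
have step_add m : a (i + m) = a (j + m).
  by elim: m => [|m IHm]; rewrite ?addn0 // !addnS; apply: step.
have per m : i <= m -> a m = a (m + (j - i)).
  by move=> /subnKC <-; rewrite step_add; congr a; lia.
have perM c : a N = a (N + c * (j - i)).
  elim: c => [|c ->]; first by rewrite addn0.
  by rewrite mulSn per; [congr a|]; lia.
have /dvdnP[c ->] : (j - i) %| N`! by apply: dvdn_fact; lia.
exact: perM.
Qed.

(** * Degrees as invariants of coverings *)

Definition degree (v : place) : nat :=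
  match v with Hub => 5 | Inner _ => 4 | Outer _ => 3 end.

Lemma actK (b : bool) (s : {perm arm}) : involutive s -> involutive (act b s).
Proof. by case: b. Qed.

Lemma act_swapxK (b : bool) : involutive (act b swapx).
Proof. exact: actK swapxK. Qed.

Lemma act_swapyK (b : bool) : involutive (act b swapy).
Proof. exact: actK swapyK. Qed.

(** Since the swaps are involutions, the ring edge arriving at an arm is the one leaving its
    partner. *)
Definition star_seq (b : bool) (v : place) : seq (edge * bool) :=
  match v with
  | Hub => [:: (Track, false); (Track, true); (Spoke None, false);
               (Spoke (Some false), false); (Spoke (Some true), false)]
  | Inner i => [:: (Spoke i, true); (Link i, false); (Inring i, false);
                   (Inring (act b swapx i), true)]
  | Outer i => [:: (Link i, true); (Outring i, false);
                   (Outring (act b swapy i), true)]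
  end.

Lemma star_seqP (b : bool) (v : vertex (quot b)) (d : dart (quot b)) :
  src d = v <-> d \in star_seq b v.
Proof.
split=> [<-|].
  move: d => [[|i|i|i|i] []] //=;
    rewrite !inE ?act_swapxK ?act_swapyK ?eqxx ?orbT //.
  by case: i => [[]|].
by case: v => [|i|i] /=; rewrite !inE;
   repeat (case/orP; [by move/eqP=> -> /=; rewrite ?act_swapxK ?act_swapyK|]);
   move/eqP=> -> /=; rewrite ?act_swapxK ?act_swapyK.
Qed.

Lemma card_star_quot (b : bool) (v : vertex (quot b)) :
  star v #= `I_(degree v).
Proof.
have size_star : size (star_seq b v) = degree v by case: v.
have uniq_star : uniq (star_seq b v).
  by case: (v) => [|k|k] //=; rewrite !inE !xpair_eqE /= !andbF.
have -> : star v = nth (Track, false) (star_seq b v) @` `I_(degree v).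
  apply/seteqP; split=> [d /star_seqP/(nthP (Track, false))[k kv <-]|
                         d [k kv <-]].
    by exists k => //=; rewrite -size_star.
  by apply/star_seqP; rewrite mem_nth ?size_star.
apply: inj_card_eq => i j; rewrite !inE /= -size_star => iv jv /eqP.
by rewrite nth_uniq // => /eqP.
Qed.

(** Both sides count the darts at [v], because coverings are bijective on stars. *)
Lemma degree_covering (G : graph) (b c : bool) (p : morphism G (quot b))
    (q : morphism G (quot c)) (v : vertex G) : covering p -> covering q ->
  degree (mvertex p v) = degree (mvertex q v).
Proof.
move=> [_ /(_ v)/pcard_eq pv] [_ /(_ v)/pcard_eq qv]; apply/card_eq_II.
apply: card_eq_trans (card_esym (card_star_quot _)) _.
apply: card_eq_trans (card_esym pv) _.
exact: card_eq_trans qv (card_star_quot _).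
Qed.

(** * Excluding a finite intermediate graph *)

Section NoIntermediate.
Context (N : graph) (f : morphism (cover true) N)
  (q : forall b, morphism N (quot b)).
Hypotheses (fcov : covering f) (qcov : forall b, covering (q b)).

Let h b := compm f (q b).

(** The arbitrary covering [h b] is compared with the projection, which sends [(g, v)] to [v]. *)
Lemma degree_lift (b : bool) (g : lamplighter) (v : place) :
  degree (mvertex (h b) (g, v)) = degree v.
Proof.
exact: (@degree_covering (cover true) _ _ (h b) _ (g, v)
  (covering_comp fcov (qcov b)) (projection_covering _ _ _)).
Qed.

Lemma degree_fibre (g g' : lamplighter) (v v' : place) :
  mvertex f (g, v) = mvertex f (g', v') -> degree v = degree v'.
Proof.
move=> fE; rewrite -(degree_lift true g v) -(degree_lift true g' v').
by rewrite /h /= fE.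
Qed.

Lemma lift_dart (d : dart (cover true)) (u : vertex (cover true)) :
  mvertex f (src d) = mvertex f u ->
  exists2 d', src d' = u & mdart f d' = mdart f d.
Proof.
move=> fE; have [_ _ onto] := fcov.2 u.
have [|d' uE dE] := onto (mdart f d); first by rewrite /star /= msrc.
by exists d'.
Qed.

Lemma mdart_inj (d d' : dart (cover true)) :
  src d = src d' -> mdart f d = mdart f d' -> d = d'.
Proof.
by move=> dd'; have [_ inj _] := fcov.2 (src d); apply: inj; rewrite inE.
Qed.

(** The next track dart, lifted to the other hub, must lead to a hub again, so it follows the track
    forward or backward; going backward would contradict injectivity on the star. *)
Lemma track_step (g g' : lamplighter) :
  mdart f ((g, Track), false) = mdart f ((g', Track), false) ->
  mdart f ((rword g [:: Fwd], Track), false) =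
  mdart f ((rword g' [:: Fwd], Track), false).
Proof.
move=> fE.
have fE' : mdart f ((g, Track), true) = mdart f ((g', Track), true).
  by rewrite -[((g, Track), true)]/(inv (((g, Track), false) : dart (cover true)))
    minv fE -minv.
pose d : dart (cover true) := ((rword g [:: Fwd], Track), false).
have [|d' d'src d'E] := @lift_dart d (rword g' [:: Fwd], Hub).
  rewrite -(msrc f d)
    -[(rword g' _, _)]/(src (((g', Track), true) : dart (cover true))).
  by rewrite -msrc -fE' !msrc.
have deg : degree (tgt d').2 = 5.
  have -> : 5 = degree (tgt d).2 by [].
  move: (tgt d') (tgt d) (morphism_tgt f d') (morphism_tgt f d) =>
    [k v] [k' v'].
  by rewrite d'E => -> /degree_fibre.
move: d' d'src d'E deg => [[k e] o] /=.
case: o; case: e => [|i|i|i|i] //= /(congr1 fst) /= kg' dE _;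
  last by rewrite -kg' -dE.
(* The backward case: [d] would have the same image as the reversed track dart at its own source. *)
have kE := can_inj (rwordK _) kg'.
by move: dE; rewrite kE -fE' => /mdart_inj => /(_ erefl).
Qed.

(** Track darts are followed rather than hubs, since a dart also records the direction of travel. *)
Lemma hub_period : finite_graph N -> exists2 k, 0 < k & forall g,
  mvertex f (g, Hub) = mvertex f (rword g (nseq k Fwd), Hub).
Proof.
move=> [_ /finite_period[m [k [k_gt0 per]]]]; exists k => // g.
(* Starting [m] steps back puts [g] at index [m], where periodicity is available. *)
pose g0 := rword g (word_inv (nseq m Fwd)).
have fwd n : rword (rword g0 (nseq n Fwd)) [:: Fwd] = rword g0 (nseq n.+1 Fwd).
  by rewrite rword_cat -(nseqD n 1) addn1.
have := per (fun n => mdart f ((rword g0 (nseq n Fwd), Track), false)).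
have -> : rword g (nseq k Fwd) = rword g0 (nseq (m + k) Fwd).
  by rewrite nseqD -rword_cat [rword g0 _]rwordVK.
have {1}-> : g = rword g0 (nseq m Fwd) by rewrite [RHS]rwordVK.
move=> /(_ _)/(congr1 (@src N)).
rewrite !msrc /=; apply=> i j /track_step.
by rewrite !fwd.
Qed.

(** The spoke lifts to the other hub, and by degree its lift ends at an inner vertex, possibly on a
    different arm. *)
Lemma inner_over_hub (g g' : lamplighter) (i : arm) :
  mvertex f (g, Hub) = mvertex f (g', Hub) ->
  exists j, mvertex f (g, Inner i) = mvertex f (g', Inner j).
Proof.
move=> fE; pose d : dart (cover true) := ((g, Spoke i), false).
have [//|d' d'src d'E] := @lift_dart d (g', Hub).
have tgtE : mvertex f (tgt d') = mvertex f (g, Inner i).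
  by rewrite -morphism_tgt d'E morphism_tgt /tgt /= rword_nil.
case: d' d'src {d'E} tgtE => [[k [|j|j|j|j]] [] //= [<-]].
- by move=> /degree_fibre.
- by move=> /degree_fibre.
- by rewrite /tgt /= rword_nil => <-; exists j.
Qed.

(** An inner vertex has one neighbour of each degree, so degrees alone determine where a covering
    sends neighbours. *)
Lemma adjacent_inner (b : bool) (i : arm) (v : vertex (quot b)) :
  adjacent (Inner i : vertex (quot b)) v ->
  (degree v = 4 -> v = Inner (act b swapx i)) /\
  (degree v = 3 -> v = Outer i).
Proof.
move=> [[[|j|j|j|j] []] [/= srcE <-]] //=; move: srcE => [<-] //.
by rewrite act_swapxK.
Qed.

Lemma adjacent_outer (b : bool) (i : arm) (v : vertex (quot b)) :
  adjacent (Outer i : vertex (quot b)) v ->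
  (degree v = 4 -> v = Inner i) /\
  (degree v = 3 -> v = Outer (act b swapy i)).
Proof.
move=> [[[|j|j|j|j] []] [/= srcE <-]] //=; move: srcE => [<-] //.
by rewrite act_swapyK.
Qed.

Lemma pressx_label (b : bool) (g : lamplighter) (i j : arm) :
  mvertex (h b) (g, Inner i) = Inner j ->
  mvertex (h b) (rword g [:: PressX], Inner (swapx i)) =
    Inner (act b swapx j).
Proof.
move=> hE.
have /(morphism_adjacent (h b)) : adjacent ((g, Inner i) : vertex (cover true))
    (rword g [:: PressX], Inner (swapx i)) by exists ((g, Inring i), false).
by rewrite hE => /adjacent_inner[+ _]; apply; rewrite degree_lift.
Qed.

(** The walk goes to the outer vertex, through its ring edge and back in; degrees identify the image
    of each vertex on the way. *)
Lemma pressy_label (b : bool) (g : lamplighter) (i j : arm) :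
  mvertex (h b) (g, Inner i) = Inner j ->
  mvertex (h b) (rword g [:: PressY], Inner (swapy i)) =
    Inner (act b swapy j).
Proof.
move=> hE.
have link g' i' :
    adjacent ((g', Inner i') : vertex (cover true)) (g', Outer i').
  by exists ((g', Link i'), false); rewrite /tgt /= rword_nil.
have ring : adjacent ((g, Outer i) : vertex (cover true))
    (rword g [:: PressY], Outer (swapy i)) by exists ((g, Outring i), false).
have outer : mvertex (h b) (g, Outer i) = Outer j.
  have /(morphism_adjacent (h b)) := link g i.
  by rewrite hE => /adjacent_inner[_]; apply; rewrite degree_lift.
have pressed : mvertex (h b) (rword g [:: PressY], Outer (swapy i)) =
    Outer (act b swapy j).
  have /(morphism_adjacent (h b)) := ring.
  by rewrite outer => /adjacent_outer[_]; apply; rewrite degree_lift.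
have /adjacent_sym/(morphism_adjacent (h b)) :=
  link (rword g [:: PressY]) (swapy i).
by rewrite pressed => /adjacent_outer[+ _]; apply; rewrite degree_lift.
Qed.

Lemma inner_label (b : bool) (g : lamplighter) (i : arm) :
  exists j, mvertex (h b) (g, Inner i) = Inner j.
Proof.
have := degree_lift b g (Inner i).
by case: (mvertex _ _) => [//|j _|//]; exists j.
Qed.

(** Spokes at one hub have distinct images, and a spoke of [quot b] is determined by its inner
    end. *)
Lemma inner_label_inj (b : bool) (g : lamplighter) (i i' : arm) :
  mvertex (h b) (g, Inner i) = mvertex (h b) (g, Inner i') -> i = i'.
Proof.
move=> hE; pose d j : dart (cover true) := ((g, Spoke j), false).
have hhub : mvertex (h b) (g, Hub) = Hub.
  by have := degree_lift b g Hub; case: (mvertex _ _).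
have tgt_d j : tgt (d j) = (g, Inner j) by rewrite /tgt /= rword_nil.
have [_ inj _] := (covering_comp fcov (qcov b)).2 (g, Hub).
suff : d i = d i' by case.
apply: inj; rewrite ?inE //=.
have [j hj] := inner_label b g i.
have spoke k : mvertex (h b) (g, Inner k) = Inner j ->
    mdart (h b) (d k) = (Spoke j, false).
  move=> hk; have := msrc (h b) (d k); have := morphism_tgt (h b) (d k).
  rewrite tgt_d hk; rewrite [mvertex _ (src _)]hhub.
  by case: (mdart _ _) => [[|l|l|l|l] []] //= [->].
by rewrite [LHS](spoke i hj) [RHS](spoke i') // -hE.
Qed.

Lemma no_finite_intermediate : ~ finite_graph N.
Proof.
move=> /hub_period[k k_gt0 per].
(* The arm [i'] comes from a fibre of [f], so one choice serves both values of [b]. *)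
have stepx g i : exists i', forall b j, mvertex (h b) (g, Inner i) = Inner j ->
    mvertex (h b) (rword g (PressX :: nseq k Fwd), Inner i') =
      Inner (act b swapx j).
  have [i' fE] := inner_over_hub (swapx i) (per (rword g [:: PressX])).
  exists i' => b j /pressx_label <-; rewrite -cat1s -rword_cat.
  by rewrite /h /= fE.
have stepy g i : exists i', forall b j, mvertex (h b) (g, Inner i) = Inner j ->
    mvertex (h b) (rword g (PressY :: nseq k Bwd), Inner i') =
      Inner (act b swapy j).
  (* Periods shift forward, so the period is used at the end point of the backward run and read in
     reverse. *)
  pose g' := rword g (PressY :: nseq k Bwd).
  have g'E : rword g' (nseq k Fwd) = rword g [:: PressY].
    rewrite rword_cat -cat1s -catA -rword_cat rword_id // => -[n i'].
    by rewrite word_act_cat /= word_act_fwd word_act_bwd addrK.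
  have := per g'; rewrite g'E => /esym perg'.
  have [i' fE] := inner_over_hub (swapy i) perg'.
  exists i' => b j /pressy_label <-.
  by rewrite /h /= fE.
pose u := PressX :: nseq k Fwd ++ PressY :: nseq k Bwd.
have step g i : exists i', forall b j, mvertex (h b) (g, Inner i) = Inner j ->
    mvertex (h b) (rword g u, Inner i') =
      Inner (act b swapy (act b swapx j)).
  have [i1 e1] := stepx g i.
  have [i2 e2] := stepy (rword g (PressX :: nseq k Fwd)) i1.
  by exists i2 => b j /e1/e2; rewrite rword_cat.
have [i1 e1] := step lone None; have [i2 e2] := step (rword lone u) i1.
have tour b j : mvertex (h b) (lone, Inner None) = Inner j ->
    mvertex (h b) (lone, Inner i2) = Inner
      (act b swapy (act b swapx (act b swapy (act b swapx j)))).
  by move=> /e1/e2; rewrite tour_closed.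
(* For [b = false] no label changes, so the tour ends at the arm where it began. *)
have i2E : i2 = None.
  have [j hj] := inner_label false lone None.
  by apply: (@inner_label_inj false lone); rewrite (tour _ _ hj) hj.
(* For [b = true] the label [j] would be fixed by the square of a 3-cycle, which moves every arm. *)
have [j hj] := inner_label true lone None.
have := tour _ _ hj; rewrite i2E hj => -[].
by case: j {hj} => [[]|]; rewrite /act /swapx /swapy !permE.
Qed.

End NoIntermediate.

(** * Assembling the example *)

Theorem theorem1p1 :
  exists (G G1 G2 : graph) (p1 : morphism G G1) (p2 : morphism G G2),
    (connected_graph G /\ connected_graph G1 /\ connected_graph G2) /\
    (regular_covering p1 /\ regular_covering p2) /\
    (finite_graph G1 /\ finite_graph G2) /\
    ~ (exists Ghat : graph,
         finite_graph Ghat /\ covers G Ghat /\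
         covers Ghat G1 /\ covers Ghat G2).
Proof.
have reg2 := projection_regular head (tail true) volt.
have reg1 := regular_comp_isomorphism untwist_isomorphism
  (projection_regular head (tail false) volt).
exists (cover true), (quot false), (quot true),
  (compm untwist (projection head (tail false) volt)),
  (projection head (tail true) volt).
split; [|split; [split; [exact: reg1|exact: reg2]|split]].
- split; [|split]; first exact: connected_cover.
    by have [[surj _] _ _] := reg1; exact: connected_image surj connected_cover.
  by have [[surj _] _ _] := reg2; exact: connected_image surj connected_cover.
- by split; exact: finite_quot.
- move=> [N [Nfin [[f fcov] [[q1 q1cov] [q2 q2cov]]]]].
  apply: (@no_finite_intermediate N f
    (fun b => if b return morphism N (quot b) then q2 else q1)) Nfin => //.
  by case.
Qed.
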